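(* Let $H$ be a finite $p$-group, $p$ a prime, and let $q$ be a prime power not divisible by $p$. If $S\subseteq\mathrm{Sym}(H)$ is a solving set for every colored Cayley digraph over $H$, then $S$ is a solving set for every group code (right ideal) $I$ of $\mathbb{F}_q[H]$. In particular, if $H$ is a CI-group with respect to colored Cayley digraphs, then $H$ is a CI-group with respect to semisimple group codes over $H$.
   Context: Elements of $\mathbb{F}_q[H]$ are identified with functions $H\to\mathbb{F}_q$ (vectors in $\mathbb{F}_q^H$); a group code is a right ideal of $\mathbb{F}_q[H]$, and it is semisimple when $\gcd(q,|H|)=1$. Permutations act on the right; for $g\in\mathrm{Sym}(H)$, $f^g(\omega)=f(\omega^{g^{-1}})$ and for a subspace $C$, $C^g=\{f^g:f\in C\}$. $H_R\le\mathrm{Sym}(H)$ is the group of right translations $x\mapsto xh$. A colored Cayley digraph over $H$ is $\mathrm{Cay}(H,\phi)$ for a function $\phi:H\to F$ to a set of colors $F$: vertex set $H$, arc $(x,y)$ colored $\phi(xy^{-1})$. For a colored digraph $\Gamma=(H,c)$ and $g\in\mathrm{Sym}(H)$, $\Gamma^g=(H,d)$ with $d(\alpha^g,\beta^g)=c(\alpha,\beta)$. A Cayley object over $H$ (of a given kind: colored digraph on $H$, or code in $\mathbb{F}_q^H$) is one invariant under $H_R$. $S\subseteq\mathrm{Sym}(H)$ is a solving set for a Cayley object $K$ if every Cayley object $K'$ of the same kind with $K'=K^g$ for some $g\in\mathrm{Sym}(H)$ satisfies $K'=K^s$ for some $s\in S$. $K$ is a CI-object if every such $K'$ satisfies $K'=K^\sigma$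 for some $\sigma\in\mathrm{Aut}(H)$; $H$ is a CI-group with respect to a class of Cayley objects if every object in the class is a CI-object. *)

(* Defs.v *)
From HB Require Import structures.
From mathcomp Require Import all_boot all_order all_algebra all_fingroup all_solvable all_field.

Set Implicit Arguments.
Unset Strict Implicit.
Unset Printing Implicit Defensive.

Import GRing.Theory.
Local Open Scope ring_scope.

(* Sym(H) is {perm H}; permutations compose from left to right in MathComp,   *)
(* (s * t)%g x = t (s x), so they act on the right.                           *)

Section CayleyObjects.

Variable H : finGroupType.

Definition right_translations : {set {perm H}} :=
  [set perm (mulIg h) | h : H].

(* K is a kind of objects on the set H, with Sym(H) acting by act k g = k^g. *)
Variables (K : Type) (act : K -> {perm H} -> K).

Definition cayley_object (k : K) : Prop :=
  forall t, t \in right_translations -> act k t = k.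

Definition solving_set (S : {set {perm H}}) (k : K) : Prop :=
  forall k', cayley_object k' -> (exists g, k' = act k g) ->
    exists2 s, s \in S & k' = act k s.

Definition CI_object (k : K) : Prop :=
  forall k', cayley_object k' -> (exists g, k' = act k g) ->
    exists2 sigma, sigma \in Aut [set: H] & k' = act k sigma.

End CayleyObjects.

Section ColoredDigraphs.

Variables (H : finGroupType) (F : Type).

(* The value at (x, y) is the color of the arc (x, y). *)
Definition cdigraph : Type := {ffun H * H -> F}.

(* d (x, y) = c (x^(g^-1), y^(g^-1)), i.e., d (a^g, b^g) = c (a, b). *)
Definition cdigraph_act (c : cdigraph) (g : {perm H}) : cdigraph :=
  [ffun xy => c ((g^-1)%g xy.1, (g^-1)%g xy.2)].

Definition Cay (phi : H -> F) : cdigraph :=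
  [ffun xy => phi (xy.1 * xy.2^-1)%g].

Lemma cdigraph_actE (c : cdigraph) g a b :
  cdigraph_act c g (g a, g b) = c (a, b).
Proof. by rewrite ffunE /= !permK. Qed.

Lemma Cay_cayley phi : cayley_object cdigraph_act (Cay phi).
Proof.
move=> _ /imsetP[h _ ->]; apply/ffunP=> -[x y]; rewrite !ffunE /=.
set t := perm _; rewrite -{2}(permKV t x) -{2}(permKV t y).
by rewrite /t !permE invMg mulgA mulgK.
Qed.

Lemma cayleyP (c : cdigraph) :
  cayley_object cdigraph_act c -> exists phi, c = Cay phi.
Proof.
move=> cc; exists (fun x => c (x, 1%g)); apply/ffunP=> -[x y].
have ty : perm (mulIg y^-1%g) \in right_translations H by apply: imset_f.
by rewrite -{2}(cc _ ty) -(cdigraph_actE c (perm (mulIg y^-1%g))) cc //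
  !ffunE /= !permE mulgV.
Qed.

End ColoredDigraphs.

(* The group algebra F[H], its elements being identified with functions;      *)
(* F^o is F regarded as a vector space over itself.                           *)
Notation galg H F := {ffun H -> F^o%type}.

Section GroupCodes.

Variables (H : finGroupType) (F : finFieldType).
Local Notation galg := (galg H F).

Definition galg_mul (a b : galg) : galg :=
  [ffun x => \sum_(y : H) \sum_(z : H | (y * z)%g == x) (a y * b z : F^o)].

Definition galg_act (g : {perm H}) (f : galg) : galg :=
  [ffun w => f ((g^-1)%g w)].

Lemma galg_act_is_linear g : linear (galg_act g).
Proof. by move=> k u v; apply/ffunP=> w; rewrite !ffunE. Qed.

HB.instance Definition _ g :=
  GRing.isLinear.Build F galg galg *:%R (galg_act g) (galg_act_is_linear g).

(* C^g = {f^g : f in C} *)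
Definition code_act (C : {vspace galg}) (g : {perm H}) : {vspace galg} :=
  (linfun (galg_act g) @: C)%VS.

Lemma code_actP (C : {vspace galg}) g f :
  reflect (exists2 f', f' \in C & f = galg_act g f') (f \in code_act C g).
Proof.
by apply: (iffP memv_imgP) => -[f' Cf' ->]; exists f'; rewrite ?lfunE.
Qed.

(* Right ideals of F[H] are subspaces, since F embeds in F[H] centrally. *)
Definition right_ideal (C : {vspace galg}) : Prop :=
  forall a b, a \in C -> galg_mul a b \in C.

Lemma galg_mulE (a b : galg) :
  galg_mul a b = \sum_(h : H) b h *: galg_act (perm (mulIg h)) a.
Proof.
apply/ffunP=> x; rewrite ffunE (exchange_big_dep predT) //= sum_ffunE.
apply: eq_bigr => h _; rewrite !ffunE; set t := perm _.
have tx : (t^-1)%g x = (x * h^-1)%g.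
  by apply: (@perm_inj _ t); rewrite permKV permE mulgKV.
rewrite (big_pred1 (x * h^-1)%g) ?tx 1?[LHS]mulrC // => y /=.
by rewrite (can2_eq (mulgK h) (mulgKV h)).
Qed.

Lemma right_ideal_cayley (C : {vspace galg}) :
  right_ideal C <-> cayley_object code_act C.
Proof.
have dE a h : galg_mul a [ffun x => (x == h)%:R] = galg_act (perm (mulIg h)) a.
  rewrite galg_mulE (bigD1 h) //= ffunE eqxx scale1r big1 ?addr0 // => k kh.
  by rewrite ffunE (negPf kh) scale0r.
have sub h : right_ideal C -> (code_act C (perm (mulIg h)) <= C)%VS.
  by move=> rC; apply/subvP=> f /code_actP[f' Cf' ->]; rewrite -dE; apply: rC.
split=> [rC _ /imsetP[h _ ->]|cC a b Ca].
  apply/eqP; rewrite eqEsubv sub //=; apply/subvP=> f Cf; apply/code_actP.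
  exists (galg_act (perm (mulIg h^-1%g)) f); first by rewrite -dE; apply: rC.
  apply/ffunP=> x; rewrite !ffunE; congr (f _); apply: (canRL (permK _)).
  by apply: (canRL (permK _)); rewrite !permE mulgKV.
rewrite galg_mulE; apply: memv_suml => h _; apply: memvZ.
have /cC <- : perm (mulIg h) \in right_translations H by apply: imset_f.
by apply/code_actP; exists a.
Qed.

End GroupCodes.

Definition CI_group_cdigraphs (H : finGroupType) : Prop :=
  forall (F : Type) (phi : H -> F), CI_object (@cdigraph_act H F) (Cay phi).

Definition CI_group_semisimple_codes (H : finGroupType) : Prop :=
  forall F : finFieldType, coprime #|F| #|H| ->
  forall I : {vspace galg H F}, right_ideal I -> CI_object (@code_act H F) I.

(* Main.v *)
Require Import Defs.
From HB Require Import structures.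
From mathcomp Require Import all_boot all_order all_algebra all_fingroup all_solvable all_field.

(** If [I] and [I^g] are both invariant under the right translations [H_R],
    then [H_R] and its conjugate by [g^-1] are [p]-subgroups of the stabilizer
    of [I] in Sym(H); by Sylow's theorem [g] can be changed, without changing
    [I^g], so that both lie in one [p]-subgroup [P] of this stabilizer. As [p]
    is invertible in [F_q], averaging a projection onto [I] over [P] gives a
    [P]-equivariant projection [e] onto [I]. The matrix of [e], read as a
    coloring of the arcs, is a Cayley digraph [E] whose image [E^g] is again a
    Cayley digraph. So [E^g = E^s] for some [s] in [S], and since [I] is the
    image of [e], this yields [I^g = I^s]. *)

Set Implicit Arguments.
Unset Strict Implicit.
Unset Printing Implicit Defensive.

Import GRing.Theory.
Local Open Scope ring_scope.

Section RightTranslations.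

Variable H : finGroupType.

Lemma right_translations_group_set : group_set (right_translations H).
Proof.
apply/group_setP; split=> [|_ _ /imsetP[a _ ->] /imsetP[b _ ->]].
  by apply/imsetP; exists 1%g => //; apply/permP=> x; rewrite perm1 permE mulg1.
apply/imsetP; exists (a * b)%g => //.
by apply/permP=> x; rewrite permM !permE mulgA.
Qed.

Canonical right_translations_group := Group right_translations_group_set.

Lemma card_right_translations : #|right_translations H| = #|H|.
Proof.
rewrite card_imset // => a b /permP/(_ 1%g).
by rewrite !permE !mul1g.
Qed.

Lemma pgroup_right_translations p :
  (p.-group [set: H])%g -> (p.-group (right_translations H))%g.
Proof. by rewrite /pgroup card_right_translations cardsT. Qed.

Lemma cdigraph_actM (F : Type) (c : cdigraph H F) g h :
  cdigraph_act (cdigraph_act c g) h = cdigraph_act c (g * h)%g.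
Proof. by apply/ffunP=> xy; rewrite !ffunE /= invMg !permM. Qed.

End RightTranslations.

Section CodeAction.

Variables (H : finGroupType) (F : finFieldType).
Implicit Types (f : galg H F) (C : {vspace galg H F}) (g h : {perm H}).

Lemma galg_actM g h f : galg_act h (galg_act g f) = galg_act (g * h)%g f.
Proof. by apply/ffunP=> w; rewrite !ffunE invMg permM. Qed.

Lemma galg_act1 f : galg_act 1%g f = f.
Proof. by apply/ffunP=> w; rewrite !ffunE invg1 perm1. Qed.

Lemma code_actM C g h : code_act (code_act C g) h = code_act C (g * h)%g.
Proof.
apply/vspaceP=> f; apply/code_actP/code_actP=> [[_ /code_actP[f' Cf' ->] ->]|].
  by exists f'; rewrite ?galg_actM.
case=> f' Cf' ->; exists (galg_act g f'); last by rewrite galg_actM.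
by apply/code_actP; exists f'.
Qed.

Lemma code_act1 C : code_act C 1%g = C.
Proof.
apply/vspaceP=> f; apply/code_actP/idP=> [[f' Cf' ->]|Cf].
  by rewrite galg_act1.
by exists f; rewrite ?galg_act1.
Qed.

Definition code_stab C : {set {perm H}} := [set g | code_act C g == C].

Lemma code_stab_group_set C : group_set (code_stab C).
Proof.
apply/group_setP; split=> [|g h]; first by rewrite inE code_act1.
by rewrite !inE => /eqP Cg /eqP Ch; rewrite -code_actM Cg Ch.
Qed.

Canonical code_stab_group C := Group (code_stab_group_set C).

Lemma code_stab_mem C g f : g \in code_stab C -> f \in C -> galg_act g f \in C.
Proof.
by rewrite inE => /eqP{2}<- Cf; apply/code_actP; exists f.
Qed.

End CodeAction.

Section EquivariantProjection.

Variables (H : finGroupType) (F : finFieldType) (C : {vspace galg H F}).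
Variable P : {group {perm H}}.
Implicit Types (f : galg H F) (g : {perm H}).

(** Maschke's average of the conjugates of [projv C] by elements of [P]. The leading factor defaults
    to 0 when the order of [P] vanishes in [F]. *)
Definition avg_proj f : galg H F :=
  #|P|%:R^-1 *:
    \sum_(x in P) galg_act (x^-1)%g (projv C (galg_act x f)).

Lemma avg_proj_is_linear : linear avg_proj.
Proof.
move=> k u v; rewrite /avg_proj scalerA [k * _]mulrC -scalerA -scalerDr; congr (_ *: _).
rewrite scaler_sumr -big_split; apply: eq_bigr => x _ /=.
by rewrite !linearP.
Qed.

HB.instance Definition _ :=
  GRing.isLinear.Build F (galg H F) (galg H F) *:%R avg_proj avg_proj_is_linear.

Lemma avg_proj_act g f :
  g \in P -> avg_proj (galg_act g f) = galg_act g (avg_proj f).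
Proof.
move=> Pg; rewrite /avg_proj [RHS]linearZ /=; congr (_ *: _).
rewrite [RHS]linear_sum.
(* Replacing [x] by [g * x] turns the outer [x^-1 * g] into [x^-1] and the inner [x] into [g * x],
   as on the left. *)
rewrite [RHS](reindex_inj (mulgI g)) /=.
apply: eq_big => [x|x Px]; first by rewrite groupMl.
by rewrite !galg_actM invMg mulgKV.
Qed.

Lemma avg_proj_mem f : P \subset code_stab C -> avg_proj f \in C.
Proof.
move/subsetP=> sPC; apply/memvZ/memv_suml => x Px.
by apply: code_stab_mem; rewrite ?memv_proj // sPC ?groupV.
Qed.

(** Each [galg_act x f] lies in [C], where [projv C] is the identity, so every summand is [f]. *)
Lemma avg_proj_id f :
  P \subset code_stab C -> #|P|%:R != 0 :> F -> f \in C -> avg_proj f = f.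
Proof.
move=> /subsetP sPC nzP Cf; rewrite /avg_proj (eq_bigr (fun=> f)) => [|x Px].
  by rewrite sumr_const -scaler_nat scalerA mulVf ?scale1r.
by rewrite projv_id ?code_stab_mem ?sPC // galg_actM mulgV galg_act1.
Qed.

Definition galg_delta (v : H) : galg H F := [ffun w => (w == v)%:R].

Lemma galg_act_delta g v : galg_act g (galg_delta v) = galg_delta (g v).
Proof.
by apply/ffunP=> w; rewrite !ffunE (can2_eq (permKV g) (permK g)).
Qed.

(** The matrix of [avg_proj] in the basis of the [galg_delta v], row index first. *)
Definition avg_proj_matrix : cdigraph H F :=
  [ffun xy => avg_proj (galg_delta xy.2) xy.1].

Lemma avg_proj_matrixE w v :
  avg_proj_matrix (w, v) = avg_proj (galg_delta v) w.
Proof. by rewrite ffunE. Qed.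

Lemma avg_projE f w : avg_proj f w = \sum_v f v * avg_proj_matrix (w, v).
Proof.
have {1}->: f = \sum_v f v *: galg_delta v.
  apply/ffunP=> x; rewrite sum_ffunE (bigD1 x) //= !ffunE eqxx [_ *: _]mulr1.
  rewrite big1 ?addr0 // => v; rewrite eq_sym => /negPf xv.
  by rewrite !ffunE xv [_ *: _]mulr0.
rewrite linear_sum sum_ffunE; apply: eq_bigr => v _.
by rewrite linearZ !ffunE.
Qed.

Lemma avg_proj_matrix_act g :
  g \in P -> cdigraph_act avg_proj_matrix g = avg_proj_matrix.
Proof.
move=> Pg; apply/ffunP=> -[x y]; rewrite ffunE !avg_proj_matrixE /=.
by rewrite -galg_act_delta avg_proj_act ?groupV // ffunE invgK permKV.
Qed.

(** Equal digraphs mean that the conjugates of [avg_proj] by [g] and by [s] coincide; their images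
    are the two codes. Exchanging [g] and [s] gives the reverse inclusion. *)
Lemma avg_proj_matrix_act_sub g s :
    P \subset code_stab C -> #|P|%:R != 0 :> F ->
    cdigraph_act avg_proj_matrix g = cdigraph_act avg_proj_matrix s ->
  (code_act C g <= code_act C s)%VS.
Proof.
move=> sPC nzP /ffunP Egs; apply/subvP=> _ /code_actP[f Cf ->].
(* With e for [avg_proj], f^g = (e f)^g is the g-conjugate of e applied to f^g. Replacing it by the
   s-conjugate gives the s-image of this witness. *)
apply/code_actP; exists (avg_proj (galg_act (g * s^-1)%g f)).
  exact: avg_proj_mem.
apply/ffunP=> w; rewrite [LHS]ffunE [RHS]ffunE -{1}(avg_proj_id sPC nzP Cf) !avg_projE.
rewrite (reindex_inj (@perm_inj _ g^-1%g)).
rewrite [RHS](reindex_inj (@perm_inj _ s^-1%g)) /=.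
apply: eq_bigr => v _; have := Egs (w, v).
rewrite ![cdigraph_act _ _ _]ffunE /= => ->.
by rewrite [galg_act _ _ _]ffunE invMg invgK permM permKV.
Qed.

End EquivariantProjection.

(** If the characteristic [r] of [F] divided the order of the [p]-group [P], then [r = p], but [r]
    divides [#|F|], a power of [r] greater than 1. *)
Lemma pgroup_card_neq0 (F : finFieldType) (gT : finGroupType) (P : {group gT}) p :
  ~~ (p %| #|F|)%N -> (p.-group P)%g -> #|P|%:R != 0 :> F.
Proof.
move=> pF pP; have [r r_pr chr] := finPcharP F.
rewrite -(dvdn_pcharf chr); apply: contra pF => /(pgroupP pP _ r_pr)/eqP <-.
have := finNzRing_gt1 F; rewrite (card_pprimeChar chr).
by move: (X in (_ ^ X)%N) => [|n] // _; rewrite dvdn_exp.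
Qed.

Section SolvingCodes.

Variables (p : nat) (H : finGroupType) (F : finFieldType).
Hypotheses (pH : (p.-group [set: H])%g) (pF : ~~ (p %| #|F|)%N).

Lemma cayley_code_stab (C : {vspace galg H F}) :
  cayley_object (@code_act H F) C -> right_translations H \subset code_stab C.
Proof. by move=> cC; apply/subsetP=> t Rt; rewrite inE cC. Qed.

Lemma common_pgroup (C : {vspace galg H F}) g :
    cayley_object (@code_act H F) C ->
    cayley_object (@code_act H F) (code_act C g) ->
  exists2 P : {group {perm H}}, (p.-group P)%g /\ P \subset code_stab C &
    exists2 h, code_act C h = code_act C g &
      right_translations H \subset P /\
      (right_translations H :^ h^-1 \subset P)%g.
Proof.
move=> /cayley_code_stab sRC cCg; set R := right_translations H.
have pR : (p.-group R)%g by apply: pgroup_right_translations.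
have [P sylP sRP] := Sylow_superset sRC pR.
have sRgC : (R :^ g^-1)%g \subset code_stab C.
  (* The conjugate [g * t * g^-1] moves [C] to its [g]-image, which [t] fixes, and back. *)
  apply/subsetP=> _ /imsetP[t Rt ->]; rewrite inE /conjg invgK -!code_actM.
  by rewrite cCg // code_actM mulgV code_act1.
have pRg : (p.-group (R :^ g^-1))%g by rewrite pgroupJ.
(* Here [x] stabilizes [C] and [R :^ g^-1] lies in [P :^ x], so [h = x * g] has the same effect on
   [C] as [g], and [R :^ h^-1] lies in [P]. *)
have [x Cx sRgP] := Sylow_subJ (G := code_stab_group C)
  (Q := (right_translations_group H :^ g^-1)%G) sylP sRgC pRg.
exists P; first by rewrite (pHall_pgroup sylP) (pHall_sub sylP).
exists (x * g)%g; first by move: Cx; rewrite -code_actM inE => /eqP->.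
by split=> //; rewrite invMg conjsgM sub_conjgV.
Qed.

Lemma solving_set_code (S : {set {perm H}}) :
    (forall phi : H -> F, solving_set (@cdigraph_act H F) S (Cay phi)) ->
  forall C : {vspace galg H F}, right_ideal C ->
    solving_set (@code_act H F) S C.
Proof.
move=> solS C /right_ideal_cayley cC _ /[swap] -[g ->] cCg.
have [P [pP sPC] [h <- [sRP sRhP]]] := common_pgroup cC cCg.
have nzP := pgroup_card_neq0 pF pP.
have cE : cayley_object (@cdigraph_act H F) (avg_proj_matrix C P).
  by move=> t /(subsetP sRP) Pt; apply: avg_proj_matrix_act.
have cEh : cayley_object (@cdigraph_act H F) (cdigraph_act (avg_proj_matrix C P) h).
  (* As [h * t = t ^ h^-1 * h], it suffices that [t ^ h^-1], an element of [P], fixes the matrix. *)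
  move=> t Rt; rewrite cdigraph_actM (conjgCV h) -cdigraph_actM.
  by rewrite avg_proj_matrix_act // (subsetP sRhP) ?memJ_conjg.
have [phi Ephi] := cayleyP cE.
have [|s Ss Ehs] := solS phi _ cEh; first by exists h; rewrite Ephi.
rewrite -Ephi in Ehs; exists s => //; apply/eqP.
by rewrite eqEsubv !(avg_proj_matrix_act_sub sPC nzP).
Qed.

End SolvingCodes.

Local Close Scope ring_scope.

Theorem theorem1p3 (p : nat) (H : finGroupType)
    (p_prime : prime p) (pH : (p.-group [set: H])%g) :
  (forall (q : nat) (Fq : finFieldType), #|Fq| = q -> ~~ (p %| q) ->
     forall S : {set {perm H}},
       (forall (F : Type) (phi : H -> F),
          solving_set (@cdigraph_act H F) S (Cay phi)) ->
       forall I : {vspace galg H Fq}, right_ideal I ->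
         solving_set (@code_act H Fq) S I)
  /\
  (CI_group_cdigraphs H -> CI_group_semisimple_codes H).
Proof.
split=> [q F <- pF S solS|CI_H F cop I rI].
  by apply: (solving_set_code pH pF) => phi; apply: solS.
(* For nontrivial [H], [p] divides [#|H|], so coprimality keeps [p] from dividing [#|F|]. For
   trivial [H] the identity is the only permutation. *)
have [H1|ntH] := eqVneq [set: H] 1%g.
  move=> C' _ [g ->]; exists g => //; suff ->: g = 1%g by apply: group1.
  have all1 x : x = 1%g :> H by apply/set1gP; rewrite -H1 inE.
  by apply/permP=> x; rewrite [LHS]all1 [RHS]all1.
have [_ pdvH _] := pgroup_pdiv pH ntH.
have pF : ~~ (p %| #|F|).
  apply/negP => pF; move: (coprime_dvdl pF cop).
  by rewrite -[#|H|]cardsT prime_coprime // pdvH.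
(* Being a CI-object is, by definition, having [Aut [set: H]] as a solving set. *)
by apply: (solving_set_code pH pF _ rI) => phi; apply: CI_H.
Qed.
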